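(* Suppose that a numerical semigroup $\Lambda$ has genus $g$ and $n$ intervals of gaps, with $\lfloor\frac{n}{2}\rfloor\geq \frac{g+2}{3}$. Then $g$ and $n$ have the same parity and $\Lambda$ has ordinarization number equal to $\lfloor\frac{n}{2}\rfloor$.
   Context: $\mathbb{N}_0$ is the set of non-negative integers. A numerical semigroup is a subset of $\mathbb{N}_0$ that is closed under addition, contains $0$, and has finite complement in $\mathbb{N}_0$. The elements of the complement are called gaps, the number of gaps is the genus, the largest gap is the Frobenius number, and the smallest non-zero element of the semigroup is its multiplicity. An interval of gaps is a maximal set of consecutive integers all of which are gaps. A numerical semigroup of genus $g$ is ordinary if its gaps are all in a row, i.e. it equals $\{0,g+1,g+2,\dots\}$; $\mathbb{N}_0$ (genus $0$) counts as ordinary. The ordinarization transform $\Lambda'$ of a non-ordinary numerical semigroup $\Lambda$ with Frobenius number $F$ and multiplicity $m$ is $(\Lambda\setminus\{m\})\cup\{F\}$, which is a numerical semigroup of the same genus; the ordinarization transform of an ordinary semigroup is itself. Put $\Lambda^{(0)}=\Lambda$ and $\Lambda^{(i)}=(\Lambda^{(i-1)})'$. The ordinarization number of $\Lambda$ is the smallest $i\geq 0$ such that $\Lambda^{(i)}$ is ordinary (such $i$ exists). *)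

(* Defs.v *)
From HB Require Import structures.
From mathcomp Require Import all_boot all_order all_algebra finmap zify.

Set Implicit Arguments.
Unset Strict Implicit.
Unset Printing Implicit Defensive.

Import Order.TTheory GRing.Theory Num.Theory.
Local Open Scope fset_scope.
Local Open Scope nat_scope.

(* Finiteness of the complement is carried by the finite set [gaps], which
   [gapsE] determines uniquely from the underlying subset of [nat]. *)
Record numSemigroup := NumSemigroup {
  elements :> {pred nat};
  gaps : {fset nat};
  gapsE : forall x, (x \in gaps) = (x \notin elements);
  elements0 : 0 \in elements;
  elementsD : forall x y, x \in elements -> y \in elements -> x + y \in elements
}.

Definition genus (S : numSemigroup) : nat := #|` gaps S|.

(* The value at the genus 0 semigroup, which has no gaps, is irrelevant: that
   semigroup is ordinary. *)
Definition frobenius (S : numSemigroup) : nat := \max_(x <- gaps S) x.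

Lemma gap_le_frobenius (S : numSemigroup) x : x \notin S -> x <= frobenius S.
Proof. by rewrite -gapsE => xG; apply: (@leq_bigmax_seq _ _ _ id). Qed.

Lemma gt_frobenius_in (S : numSemigroup) x : frobenius S < x -> x \in S.
Proof. by rewrite ltnNge; apply: contraR => /gap_le_frobenius. Qed.

Lemma has_multiplicity (S : numSemigroup) : exists x, (x \in S) && (x != 0).
Proof. by exists (frobenius S).+1; rewrite gt_frobenius_in. Qed.

Definition multiplicity (S : numSemigroup) : nat := ex_minn (has_multiplicity S).

Lemma multiplicityP (S : numSemigroup) :
  [/\ multiplicity S \in S, 0 < multiplicity S
    & forall x, x \in S -> 0 < x -> multiplicity S <= x].
Proof.
rewrite /multiplicity; case: ex_minnP => m /andP[mS m0] min_m; split=> //.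
  by rewrite lt0n.
by move=> x xS x0; apply: min_m; rewrite xS -lt0n.
Qed.

(* [fset a; a + 1; ...; b] with both ends in I; in particular I is nonempty. *)
Definition consecutive (I : {fset nat}) : bool :=
  [exists a : I, exists b : I,
     I == [fset x in index_iota (fsval a) (fsval b).+1]].

Lemma consecutiveP (I : {fset nat}) :
  reflect (exists a b, a <= b /\ forall x, (x \in I) = (a <= x <= b))
          (consecutive I).
Proof.
apply: (iffP existsP) => [[a /existsP[b /eqP E]]|[a [b [leab E]]]].
  have E' x : (x \in I) = (fsval a <= x <= fsval b).
    by rewrite {1}E !inE mem_index_iota ltnS.
  exists (fsval a), (fsval b); split=> //.
  by have := fsvalP a; rewrite E' => /andP[].
have aI : a \in I by rewrite E leqnn.
have bI : b \in I by rewrite E leqnn leab.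
exists [` aI]; apply/existsP; exists [` bI]; apply/eqP/fsetP => x /=.
by rewrite E !inE mem_index_iota ltnS.
Qed.

Definition gap_intervals (S : numSemigroup) : {fset {fset nat}} :=
  [fset I in fpowerset (gaps S) | consecutive I &&
     [forall J : fpowerset (gaps S),
        consecutive (fsval J) ==> (I `<=` fsval J) ==> (fsval J == I)]].

Lemma gap_intervalsP (S : numSemigroup) (I : {fset nat}) :
  reflect [/\ I `<=` gaps S, consecutive I
             & forall J, J `<=` gaps S -> consecutive J -> I `<=` J -> J = I]
          (I \in gap_intervals S).
Proof.
rewrite !inE /= fpowersetE; apply: (iffP and3P) => -[IG cI maxI]; split=> //.
  move=> J; rewrite -fpowersetE => JG cJ IJ.
  by have /forallP/(_ [` JG]) := maxI; rewrite /= cJ IJ => /eqP.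
apply/forallP => J; apply/implyP => cJ; apply/implyP => IJ; apply/eqP.
by apply: maxI => //; rewrite -fpowersetE fsvalP.
Qed.

Definition ordinary (S : numSemigroup) : bool :=
  gaps S == [fset x in iota 1 (genus S)].

Lemma ordinaryP (S : numSemigroup) :
  reflect (forall x, (x \in S) = (x == 0) || (genus S < x)) (ordinary S).
Proof.
apply: (iffP eqP) => [E x | E].
  rewrite -[LHS]negbK -gapsE {1}E !inE mem_iota add1n ltnS negb_and -!ltnNge.
  by case: x.
by apply/fsetP => x; rewrite gapsE E !inE mem_iota negb_or -leqNgt add1n ltnS lt0n.
Qed.

Lemma multiplicity_le_genus (S : numSemigroup) : multiplicity S <= (genus S).+1.
Proof.
have [_ _ min_m] := multiplicityP S.
have sub : [fset x in iota 1 (multiplicity S).-1] `<=` gaps S.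
  apply/fsubsetP => x; rewrite !inE mem_iota gapsE => /andP[x0 xm].
  by apply/negP => /min_m/(_ x0); lia.
have := fsubset_leq_card sub.
by rewrite card_fseq undup_id ?iota_uniq // size_iota /genus; lia.
Qed.

Lemma card_fset_iota m n : #|` [fset x in iota m n]| = n.
Proof. by rewrite card_fseq undup_id ?iota_uniq // size_iota. Qed.

Lemma frobenius_gap (S : numSemigroup) : 0 < genus S -> frobenius S \in gaps S.
Proof.
rewrite /genus /frobenius -[_ \in gaps S]/(_ \in enum_fset (gaps S)).
elim: (enum_fset _) => //= x [|y s] IHs _; first by rewrite big_seq1 mem_head.
rewrite big_cons in_cons /maxn; case: ifP => _; last by rewrite eqxx.
by rewrite IHs ?orbT.
Qed.

Lemma multiplicity_lt_frobenius (S : numSemigroup) :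
  ~~ ordinary S -> multiplicity S < frobenius S.
Proof.
have [mS m0 min_m] := multiplicityP S.
apply: contraR; rewrite -leqNgt => leFm.
suff E : gaps S = [fset x in iota 1 (frobenius S)].
  by rewrite /ordinary /genus E card_fset_iota.
apply/fsetP => x; rewrite gapsE !inE mem_iota add1n ltnS.
apply/idP/idP => [xS|/andP[x0 xF]].
  rewrite gap_le_frobenius // andbT lt0n.
  by apply: contraNneq xS => ->; apply: elements0.
apply: contraL leFm => xS; rewrite -ltnNge.
have le_mx := min_m _ xS x0.
rewrite (leq_ltn_trans le_mx) // ltn_neqAle xF andbT.
apply: contraTneq xS => xF'; rewrite xF' -gapsE frobenius_gap //.
rewrite lt0n cardfs_eq0; apply: contraTneq xF => G0.
by rewrite /frobenius G0 big_nil -ltnNge.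
Qed.

Lemma non_ordinary_genus (S : numSemigroup) : ~~ ordinary S -> 0 < genus S.
Proof.
rewrite lt0n; apply: contraNneq => g0.
rewrite /ordinary g0; have /eqP := g0; rewrite cardfs_eq0 => /eqP ->.
by apply/eqP/fsetP => x; rewrite !inE.
Qed.

Section Transform.
Variables (S : numSemigroup) (nordS : ~~ ordinary S).

Let telements : {pred nat} :=
  [pred x | (x \in S) && (x != multiplicity S) || (x == frobenius S)].
Let tgaps : {fset nat} := multiplicity S |` (gaps S `\ frobenius S).

Fact transform_gapsE x : (x \in tgaps) = (x \notin telements).
Proof.
have ltmF := multiplicity_lt_frobenius nordS; have [mS _ _] := multiplicityP S.
rewrite !inE gapsE negb_or negb_and negbK.
case: (x =P multiplicity S) => [->|_]; last by rewrite orbF andbC.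
by rewrite orbT /=; lia.
Qed.

Fact transform_elements0 : 0 \in telements.
Proof. by have [_ m0 _] := multiplicityP S; rewrite inE elements0 eq_sym -lt0n m0. Qed.

Fact transform_elementsD x y :
  x \in telements -> y \in telements -> x + y \in telements.
Proof.
have ltmF := multiplicity_lt_frobenius nordS.
have [_ _ min_m] := multiplicityP S.
have above z : frobenius S < z -> z \in telements.
  by move=> Fz; rewrite inE gt_frobenius_in //=; apply/orP; left; lia.
have [->//|x0] := posnP x; have [->|y0] := posnP y; first by rewrite addn0.
move=> /orP[/andP[xS xm]|/eqP->]; last by move=> _; apply: above; lia.
move=> /orP[/andP[yS ym]|/eqP->]; last by apply: above; lia.
have := min_m _ xS x0; rewrite inE elementsD //=; lia.
Qed.

Definition transform : numSemigroup :=
  NumSemigroup transform_gapsE transform_elements0 transform_elementsD.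

End Transform.

Definition ordinarization (S : numSemigroup) : numSemigroup :=
  if @idP (~~ ordinary S) is ReflectT nordS then transform nordS else S.

Lemma mem_ordinarization (S : numSemigroup) x :
  (x \in ordinarization S) =
    if ordinary S then x \in S
    else (x \in S) && (x != multiplicity S) || (x == frobenius S).
Proof.
rewrite /ordinarization; case: {-}_ / idP => [nordS|/negP/negbNE-> //].
by rewrite (negPf nordS).
Qed.

Lemma genus_transform (S : numSemigroup) (nordS : ~~ ordinary S) :
  genus (transform nordS) = genus S.
Proof.
have [mS _ _] := multiplicityP S.
rewrite /genus /= cardfsU1 !inE gapsE mS andbF /=.
by rewrite (cardfsD1 (frobenius S) (gaps S)) frobenius_gap // non_ordinary_genus.
Qed.

Lemma multiplicity_transform (S : numSemigroup) (nordS : ~~ ordinary S) :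
  multiplicity S < multiplicity (transform nordS).
Proof.
have [_ _ min_m] := multiplicityP S.
have [+ n0 _] := multiplicityP (transform nordS).
case/orP=> [/andP[nS nm]|/eqP->]; last exact: multiplicity_lt_frobenius.
by rewrite ltn_neqAle eq_sym nm min_m.
Qed.

(* Each non-trivial step increases the multiplicity, which is at most g + 1. *)
Lemma has_ordinarization_number (S : numSemigroup) :
  exists i, ordinary (iter i ordinarization S).
Proof.
have [k] := ubnP ((genus S).+1 - multiplicity S).
elim: k S => // k IHk S lek.
have [ordS|nordS] := boolP (ordinary S); first by exists 0.
have [|i ord_i] := IHk (ordinarization S).
  rewrite /ordinarization; case: {-}_ / idP => [nord|/(_ nordS)//].
  have := multiplicity_transform nord; have := multiplicity_le_genus (transform nord).
  by rewrite genus_transform; lia.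
by exists i.+1; rewrite iterSr.
Qed.

Definition ordinarization_number (S : numSemigroup) : nat :=
  ex_minn (has_ordinarization_number S).

(* Main.v *)
Require Import Defs.
From mathcomp Require Import all_boot all_order all_algebra finmap zify.
Import GRing.Theory Num.Theory.

(** Write S for the semigroup, g for its genus, n for its number of intervals of
gaps, and r for the number of nonzero elements of S that are at most g.

Each ordinarization step removes one nonzero element of S that is at most g
(the multiplicity) and adds one element above g (the Frobenius number), and S is
ordinary exactly when r = 0; so the ordinarization number is r
([ordinarization_numberE]).

Let w be the number of x such that x and x + 1 are both gaps (twin gaps).  The
intervals of gaps correspond to the descents, i.e. the x in S with x + 1 a gap
([card_gap_intervals]), whence n + w = g, and w is also the number of twin
nongaps x < 2g, with x and x + 1 both in S.  The hypothesis gives 3w + 4 <= g: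
on [0, 2g], membership in S alternates up to few defects.

The main step ([small_nongaps_even]) is that all elements of S up to g are even.
Subtracting elements of S from a twin gap gives twin gaps, and adding elements
of S to a twin nongap gives twin nongaps.  Hence the elements of S up to the
largest twin gap q number at most w, so q is at most 3w - 2, and similarly the
least twin nongap p is at least 2g - 3w.  Between q and p membership in S
strictly alternates.  Suppose that S has an odd element o <= g, the least one.
Shifting the alternating stretch by o would reverse its parity, so o + q + 2
lies beyond p, which makes o large.  But each even gap below o yields a twin gap
that is not q - s with s in S ([even_gaps_twin_gaps]), and each large enough
even nongap below o yields a twin nongap that is not p + s with s in S
([even_nongaps_twin_nongaps]).  As there are only w twin gaps and w twin
nongaps, and gaps make up at least half of the even numbers up to the even gap
o - 1, the even numbers below o would be fewer than they are.

Once the elements up to g are even, S / 2 is a semigroup whose gaps are few and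
small.  If c is the number of even gaps, each even gap and its predecessor are
twin gaps and there are no others, so w = 2c ([defect_even]).  Then n = g - 2c
has the parity of g, and r, the number of positive even numbers up to g less c,
is half of n, rounded down. *)

(** * Counting on initial segments *)

Definition census (P : pred nat) (N : nat) : nat := count P (iota 0 N).

Lemma censusS P N : census P N.+1 = census P N + P N.
Proof. by rewrite /census -addn1 iotaD count_cat /= addn0. Qed.

Lemma census0 P : census P 0 = 0.
Proof. by []. Qed.

Lemma eq_census (P R : pred nat) N : (forall x, x < N -> P x = R x) -> census P N = census R N.
Proof. by move=> E; apply: eq_in_count => x; rewrite mem_iota => /E. Qed.

Lemma leq_census P N M : N <= M -> census P N <= census P M.
Proof. by move=> /subnKC <-; rewrite /census iotaD count_cat leq_addr. Qed.

Lemma census_inj (P R : pred nat) N M (f : nat -> nat) :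
    (forall x, x < N -> P x -> f x < M /\ R (f x)) ->
    (forall x y, x < N -> y < N -> P x -> P y -> f x = f y -> x = y) ->
  census P N <= census R M.
Proof.
move=> fPR f_inj; rewrite /census -!size_filter -(size_map f); apply: uniq_leq_size.
  rewrite map_inj_in_uniq ?filter_uniq ?iota_uniq // => x y.
  by rewrite !mem_filter !mem_iota => /andP[Px xN] /andP[Py yN]; apply: f_inj.
move=> _ /mapP[x + ->]; rewrite !mem_filter !mem_iota => /andP[Px xN].
by have [-> ->] := fPR x xN Px.
Qed.

Lemma census_const (P : pred nat) N M :
  N <= M -> (forall x, N <= x < M -> ~~ P x) -> census P M = census P N.
Proof.
move=> leNM P0; elim: M leNM P0 => [|M IHM]; first by rewrite leqn0 => /eqP->.
rewrite leq_eqVlt => /predU1P[->//|leNM] P0; rewrite censusS IHM => [|//|x xM].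
  by rewrite (negPf (P0 M _)) ?addn0 //; lia.
by apply: P0; lia.
Qed.

Lemma censusC (P : pred nat) N : census P N + census (fun x => ~~ P x) N = N.
Proof. by elim: N => // N IHN; rewrite !censusS; case: (P N) => /=; lia. Qed.

Lemma census_split (P R : pred nat) N :
  census P N = census (fun x => P x && R x) N + census (fun x => P x && ~~ R x) N.
Proof.
by elim: N => // N IHN; rewrite !censusS IHN; case: (P N); case: (R N) => /=; lia.
Qed.

Lemma census_gt0 (P : pred nat) N x : P x -> x < N -> 0 < census P N.
Proof. by move=> Px xN; rewrite -has_count; apply/hasP; exists x; rewrite ?mem_iota. Qed.

Lemma census_gt0_ex (P : pred nat) N : 0 < census P N -> exists2 x, x < N & P x.
Proof. by rewrite -has_count => /hasP[x]; rewrite mem_iota => xN Px; exists x. Qed.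

Lemma card_fset_census (P : pred nat) N :
  #|` [fset x in iota 0 N | P x]%fset|%fset = census P N.
Proof.
rewrite /census -size_filter.
have -> : [fset x in iota 0 N | P x]%fset = [fset x in filter P (iota 0 N)]%fset.
  by apply/fsetP => x; rewrite !inE mem_filter andbC.
by rewrite card_fseq undup_id ?filter_uniq ?iota_uniq.
Qed.

(** In a pair x, t - x with sum a gap t, at least one member is a gap, so gaps
make up at least half of [0, t]. *)
Lemma gap_census (s : pred nat) t :
    (forall x y, s x -> s y -> s (x + y)) -> ~~ s t ->
  t < 2 * census (fun x => ~~ s x) t.+1.
Proof.
move=> sD st; have := censusC s t.+1.
suff : census s t.+1 <= census (fun x => ~~ s x) t.+1 by lia.
apply: (@census_inj _ _ _ _ (fun x => t - x)) => [x xt sx|x y]; last by lia.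
split; first by lia.
by apply: contra st => stx; rewrite -(@subnKC x t) ?sD //; lia.
Qed.

(** * Twin gaps, twin nongaps and descents *)

Definition twin_nongap (S : numSemigroup) x := (x \in S) && (x.+1 \in S).
Definition twin_gap (S : numSemigroup) x := (x \notin S) && (x.+1 \notin S).
Definition descent (S : numSemigroup) x := (x \in S) && (x.+1 \notin S).

Lemma genus_census (S : numSemigroup) N :
  2 * genus S <= N -> census (fun x => x \notin S) N = genus S.
Proof.
have far K : frobenius S < K -> census (fun x => x \notin S) K = genus S.
  move=> FK; rewrite -card_fset_census /genus.
  congr (#|` _|%fset); apply/fsetP => x; rewrite !inE gapsE mem_iota /=.
  by case: (boolP (x \in S)) => [|/gap_le_frobenius]; lia.
move=> leN; pose K := maxn N (frobenius S).+1.
rewrite -(far K) ?leq_maxr //; apply/esym/census_const => [|x /andP[Nx _]].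
  exact: leq_maxl.
apply: contraL Nx => xS; rewrite -ltnNge; apply: leq_trans leN.
apply: leq_trans (gap_census _ x (@elementsD S) xS) _; rewrite leq_mul2l /=.
rewrite -(far (maxn x.+1 (frobenius S).+1)) ?leq_maxr //.
exact/leq_census/leq_maxl.
Qed.

Lemma in_of_double_genus (S : numSemigroup) x : 2 * genus S <= x -> x \in S.
Proof.
move=> gx; apply: contraLR (gx) => xS; rewrite -ltnNge.
rewrite -(@genus_census S x.+1); last by lia.
exact: (gap_census _ x (@elementsD S) xS).
Qed.

(** Cutting [0, N) into descents, ascents and twins: descents and ascents
alternate, so elements and gaps below N differ in number only by the twins and
a boundary term. *)
Lemma balance (S : numSemigroup) N :
  2 * census (fun x => x \in S) N + census (twin_gap S) N =
    N + census (twin_nongap S) N + (N \notin S).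
Proof.
elim: N => [|N IHN]; first by rewrite elements0.
rewrite !censusS [twin_gap S N]/(_ && _) [twin_nongap S N]/(_ && _) /=.
by case: (N \in S) IHN; case: (N.+1 \in S) => /=; lia.
Qed.

Lemma census_descent (S : numSemigroup) N :
  census (fun x => x \in S) N = census (twin_nongap S) N + census (descent S) N.
Proof. exact: (census_split (fun x => x \in S) (fun x => x.+1 \in S)). Qed.

(** * Intervals of gaps correspond to descents *)

Section Intervals.
Variable S : numSemigroup.
Local Open Scope fset_scope.

(** When a is a descent, this is the interval of gaps that starts at a + 1. *)
Definition gap_run (a : nat) : {fset nat} :=
  [fset x in gaps S | (a < x) && all (fun y => y \notin S) (iota a.+1 (x - a))].

Lemma gap_runP a x :
  reflect (a < x /\ forall y, a < y <= x -> y \notin S) (x \in gap_run a).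
Proof.
rewrite !inE /= gapsE; apply: (iffP and3P) => [[_ ax /allP H]|[ax H]].
  by split=> // y yax; apply: H; rewrite mem_iota; lia.
split=> //; first by apply: H; rewrite ax leqnn.
by apply/allP => y; rewrite mem_iota => yax; apply: H; lia.
Qed.

Lemma gap_run_consecutive a : a.+1 \notin S -> consecutive (gap_run a).
Proof.
move=> aS; have ex : exists z, (a < z) && (z \in S).
  exists (a + 2 * genus S).+1; rewrite in_of_double_genus; lia.
case: (ex_minnP ex) => z /andP[az zS] min_z.
have az1 : z != a.+1 by apply: contraNneq aS => <-.
apply/consecutiveP; exists a.+1, z.-1; split=> [|x]; first by lia.
apply/gap_runP/idP => [[ax H]|xaz].
  by rewrite ax /=; case: (ltnP x z) => [|zx]; [lia|have := H z; rewrite az zx zS => /(_ isT)].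
split=> [|y yx]; first by lia.
by apply/negP => yS; have := min_z y; rewrite yS andbT; lia.
Qed.

Lemma gap_run_sub a : gap_run a `<=` gaps S.
Proof. by apply/fsubsetP => x /gap_runP[ax]; rewrite gapsE; apply; rewrite ax leqnn. Qed.

Lemma card_gap_intervals :
  #|` gap_intervals S| = census (descent S) (2 * genus S).
Proof.
pose D := [fset x in iota 0 (2 * genus S) | descent S x].
have mem_D x : (x \in D) = descent S x.
  rewrite !inE /= mem_iota /=; apply: andb_idl => /andP[_ xS].
  by rewrite add0n; apply: contraNT xS => ?; apply: in_of_double_genus; lia.
have -> : gap_intervals S = [fset gap_run a | a in D].
  apply/fsetP => I; apply/gap_intervalsP/imfsetP => /= [[IG cI maxI]|[a aD ->]].
    have /consecutiveP[a [b [ab EI]]] := cI.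
    have gapI x : a <= x <= b -> x \notin S.
      by rewrite -EI -gapsE; apply: (fsubsetP IG).
    case: a => [|a] in ab EI gapI *; first by have := gapI 0 isT; rewrite elements0.
    have aS : a \in S.
      (* Otherwise the gap a extends I to the left. *)
      apply: contraT => aS; suff E : (a |` I) = I.
        by have := fset1U1 a I; rewrite E EI ltnn.
      apply: maxI; last exact: fsubsetU1.
        by rewrite fsubUset IG andbT fsub1set gapsE.
      apply/consecutiveP; exists a, b; split=> [|x]; first by lia.
      by rewrite in_fset1U EI; lia.
    exists a; first by rewrite mem_D /descent aS gapI //; lia.
    apply/esym/maxI; [exact: gap_run_sub|apply: gap_run_consecutive; apply: gapI; lia|].
    apply/fsubsetP => x; rewrite EI => xab; apply/gap_runP; split=> [|y yx]; first by lia.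
    by apply: gapI; lia.
  move: aD; rewrite mem_D => /andP[aS a1S].
  split; [exact: gap_run_sub|exact: gap_run_consecutive|move=> J JG cJ aJ].
  apply/eqP; rewrite eqEfsubset aJ andbT; apply/fsubsetP => x xJ.
  have /consecutiveP[b [c [bc EJ]]] := cJ.
  have gapJ y : b <= y <= c -> y \notin S.
    by rewrite -EJ -gapsE; apply: (fsubsetP JG).
  have a1J : a.+1 \in J.
    by apply: (fsubsetP aJ); apply/gap_runP; split=> // y; rewrite -eqn_leq => /eqP<-.
  move: a1J xJ; rewrite !EJ => a1J xJ.
  have ab : a < b by rewrite ltnNge; apply: contraL aS => ba; apply: gapJ; lia.
  by apply/gap_runP; split=> [|y yx]; [lia|apply: gapJ; lia].
rewrite card_in_imfset => [/=|a b]; last first.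
  rewrite !mem_D => /andP[_ aS] /andP[_ bS] E.
  have run_start c : c.+1 \notin S -> c.+1 \in gap_run c.
    by move=> cS; apply/gap_runP; split=> // y; rewrite -eqn_leq => /eqP<-.
  have /gap_runP[ba _] : a.+1 \in gap_run b by rewrite -E run_start.
  have /gap_runP[ab _] : b.+1 \in gap_run a by rewrite E run_start.
  by lia.
exact: card_fset_census.
Qed.

End Intervals.

(** * The ordinarization number counts small elements *)

(** The element 0 is counted. *)
Definition small_nongaps (S : numSemigroup) : nat :=
  census (fun x => x \in S) (genus S).+1.

Lemma small_nongaps_gt0 (S : numSemigroup) : 0 < small_nongaps S.
Proof. by apply: (@census_gt0 _ _ 0); rewrite ?elements0. Qed.

Lemma ordinary_small_nongaps (S : numSemigroup) :
  ordinary S = (small_nongaps S == 1).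
Proof.
have c1 : census (fun x => x \in S) 1 = 1 by rewrite censusS /= elements0.
have gE := @censusC (fun x => x \in S) (genus S).+1.
apply/ordinaryP/eqP => [ordS|small1 x].
  rewrite /small_nongaps -[RHS]c1; apply: census_const => // x.
  by rewrite ordS; lia.
apply/idP/idP => [xS|/predU1P[->|gx]]; last 2 first.
- exact: elements0.
- apply: contraT => xS; have := @genus_census S (maxn x.+1 (2 * genus S)) (leq_maxr _ _).
  have := leq_census (fun y => y \notin S) _ _ (leq_maxl x.+1 (2 * genus S)).
  have := leq_census (fun y => y \notin S) _ _ gx.
  by rewrite [census _ x.+1]censusS /= xS; move: gE small1; rewrite /small_nongaps; lia.
case: (posnP x) => //= x0; rewrite ltnNge; apply/negP => xg.
have := leq_census (fun y => y \in S) _ _ x0; rewrite c1.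
have : x.+1 <= (genus S).+1 by [].
move/(leq_census (fun y => y \in S)); rewrite [census _ x.+1]censusS /= xS.
by move: small1; rewrite /small_nongaps; lia.
Qed.

Lemma genus_ordinarization (S : numSemigroup) : genus (ordinarization S) = genus S.
Proof. by rewrite /ordinarization; case: {-}_ / idP => // nord; exact: genus_transform. Qed.

Lemma census_pred1 m N : m < N -> census (pred1 m) N = 1.
Proof.
move=> mN; rewrite (@census_const _ m.+1 N) //; last by move=> x /=; lia.
by rewrite censusS /= eqxx (@census_const _ 0 m) // => x /=; lia.
Qed.

Lemma small_nongaps_ordinarization (S : numSemigroup) : ~~ ordinary S ->
  small_nongaps S = (small_nongaps (ordinarization S)).+1.
Proof.
move=> nord; have [mS m0 min_m] := multiplicityP S.
have mg : multiplicity S <= genus S.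
  rewrite leqNgt; apply: contra nord => gm.
  rewrite ordinary_small_nongaps /small_nongaps (@census_const _ 1) //= => [|x xg].
    by rewrite censusS /= elements0.
  by apply/negP => xS; have := min_m x xS; lia.
have Fg : genus S < frobenius S.
  rewrite ltnNge; apply: contra nord => Fg; rewrite ordinary_small_nongaps.
  have := @censusC (fun x => x \in S) (genus S).+1.
  rewrite -(@census_const (fun x => x \notin S) _ (genus S + genus S).+1) //=.
  - by rewrite genus_census /small_nongaps; lia.
  - by rewrite ltnS leq_addr.
  - by move=> x xg; rewrite negbK gt_frobenius_in //; lia.
rewrite /small_nongaps genus_ordinarization (@census_split _ (pred1 (multiplicity S))).
rewrite (@eq_census (fun x => (x \in S) && _) (pred1 (multiplicity S))) => [|x _ /=]; last first.
  by apply: andb_idl => /eqP->.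
rewrite census_pred1 // add1n; congr _.+1; apply: eq_census => x xg /=.
by rewrite mem_ordinarization (negPf nord) [x == frobenius S](_ : _ = false) ?orbF; lia.
Qed.

Lemma ordinarization_numberE (S : numSemigroup) :
  ordinarization_number S = (small_nongaps S).-1.
Proof.
have ordE i : forall T, ordinary (iter i ordinarization T) = (small_nongaps T <= i.+1).
  elim: i => [|i IHi] T.
    by rewrite /= ordinary_small_nongaps eqn_leq small_nongaps_gt0 andbT.
  rewrite iterSr IHi; case: (boolP (ordinary T)) => [ordT|nord].
    have -> : ordinarization T = T.
      by rewrite /ordinarization; case: {-}_ / idP => // nord; have := nord; rewrite ordT.
    by move: ordT; rewrite ordinary_small_nongaps => /eqP->.
  by rewrite (small_nongaps_ordinarization _ nord).
rewrite /ordinarization_number; case: ex_minnP => i; rewrite ordE => Hi min_i.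
have := min_i (small_nongaps S).-1; rewrite ordE.
by have := small_nongaps_gt0 S; lia.
Qed.

(** * Few twins force small elements to be even *)

Definition defect (S : numSemigroup) : nat := census (twin_gap S) (2 * genus S).

Lemma twin_gap_lt (S : numSemigroup) y : twin_gap S y -> y.+1 < 2 * genus S.
Proof. by case/andP=> _; apply: contraR; rewrite -leqNgt; apply: in_of_double_genus. Qed.

Lemma twin_gap_sub (S : numSemigroup) y x :
  twin_gap S y -> x \in S -> x <= y -> twin_gap S (y - x).
Proof.
case/andP=> yS y1S xS xy; apply/andP; split.
  by apply: contra yS => H; rewrite -(subnKC xy) elementsD.
by apply: contra y1S => H; rewrite -(subnKC xy) -addnS elementsD.
Qed.

Lemma twin_nongap_add (S : numSemigroup) p x :
  twin_nongap S p -> x \in S -> twin_nongap S (p + x).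
Proof. by case/andP=> pS p1S xS; rewrite /twin_nongap -addSn !elementsD. Qed.

Lemma census_twin_nongap (S : numSemigroup) :
  census (twin_nongap S) (2 * genus S) = defect S.
Proof.
have := balance S (2 * genus S); have := genus_census S _ (leqnn _).
have := @censusC (fun x => x \in S) (2 * genus S).
by rewrite in_of_double_genus // /defect; lia.
Qed.

Lemma twin_gap_reflect (S : numSemigroup) y : twin_gap S y ->
  census (fun x => x \in S) y.+1 <=
  census (fun z => twin_gap S z && (y - z \in S)) y.+1.
Proof.
move=> Qy; apply: (@census_inj _ _ _ _ (fun x => y - x)) => [x xy xS|x z]; last by lia.
by rewrite twin_gap_sub ?subKn //; lia.
Qed.

(** By reflection at y, there are at most as many elements as twin gaps up to y;
[balance] then bounds y itself. *)
Lemma twin_gap_bound (S : numSemigroup) y : twin_gap S y -> y + 2 <= 3 * defect S.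
Proof.
move=> Qy; have le_w := leq_census (twin_gap S) _ _ (ltnW (twin_gap_lt _ _ Qy)).
have := balance S y.+1; case/andP: (Qy) => _ ->.
have := twin_gap_reflect _ _ Qy.
have := @census_split (twin_gap S) (fun z => y - z \in S) y.+1.
by move: le_w; rewrite -/(defect S); lia.
Qed.

Lemma twin_nongap_translate (S : numSemigroup) p : twin_nongap S p ->
  census (fun x => x \in S) (2 * genus S - p) <=
  census (fun z => twin_nongap S z && ((p <= z) && (z - p \in S))) (2 * genus S).
Proof.
move=> Pp; apply: (@census_inj _ _ _ _ (addn p)) => [x xy xS|x z]; last by lia.
by rewrite twin_nongap_add // leq_addr addKn; split=> //; lia.
Qed.

(** The analogue of [twin_gap_bound] seen from the end 2g, with translation by p
instead of reflection. *)
Lemma twin_nongap_bound (S : numSemigroup) p :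
  twin_nongap S p -> 2 * genus S <= p + 3 * defect S.
Proof.
move=> Pp; have := balance S (2 * genus S - p); have := twin_nongap_translate _ _ Pp.
have := @census_split (twin_nongap S) (fun z => (p <= z) && (z - p \in S)) (2 * genus S).
have := leq_census (twin_gap S) _ _ (leq_subr p (2 * genus S)).
by rewrite census_twin_nongap -/(defect S); lia.
Qed.

Ltac lia_no_mem := repeat match goal with
  | H : is_true (_ \in _) |- _ => clear H
  | H : is_true (~~ _) |- _ => clear H
  | H : is_true (twin_gap _ _) |- _ => clear H
  | H : is_true (twin_nongap _ _) |- _ => clear H
  | H : _ = _ :> bool |- _ => clear H
  end; lia.

Lemma twin_free_alternate (S : numSemigroup) q p :
    q.+1 \notin S ->
    (forall y, q < y < p -> ~~ twin_gap S y && ~~ twin_nongap S y) ->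
  forall y, q < y <= p -> (y \in S) = (odd y == odd q).
Proof.
move=> q1S noPQ; elim=> [//|y IHy] /andP[qy yp].
move: qy; rewrite ltnS leq_eqVlt => /predU1P[<-|qy].
  by rewrite (negPf q1S) /=; case: (odd q).
have := IHy; have := noPQ y; rewrite qy yp (ltnW yp) => /(_ isT) + /(_ isT).
rewrite /twin_gap /twin_nongap /=.
by case: (y \in S); case: (y.+1 \in S); case: (odd y); case: (odd q).
Qed.

(** As all odd numbers up to 2t - 1 are gaps, an even gap e < 2t makes e - 1 and
e twin gaps.  They are not both of the form q - s with s in S, because the two
values of s would be consecutive, i.e. a twin nongap up to q.  Whichever escapes
this form is counted in addition to the reflections of S at q. *)
Lemma even_gaps_twin_gaps (S : numSemigroup) q t :
    (forall y, twin_gap S y -> y <= q) -> twin_gap S q ->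
    (forall y, y <= q -> ~~ twin_nongap S y) ->
    (forall y, y < t.*2.+1 -> odd y -> y \notin S) ->
  census (fun x => x \in S) q.+1 + census (fun i => i.*2 \notin S) t
    <= census (twin_gap S) q.+1.
Proof.
move=> max_q Qq noP oS.
rewrite (@census_split (twin_gap S) (fun z => q - z \in S)).
apply: leq_add; first exact: twin_gap_reflect.
pose f i := if q - i.*2 \in S then i.*2.-1 else i.*2.
apply: (@census_inj _ _ _ _ f) => [i it iS|i j it jt iS jS].
  have i0 : 0 < i by case: (i) iS => //; rewrite elements0.
  have i1S : i.*2.-1 \notin S by apply: oS; lia_no_mem.
  have i2S : i.*2.+1 \notin S by apply: oS; lia_no_mem.
  have Q2 : twin_gap S i.*2 by rewrite /twin_gap iS.
  have iE : i.*2.-1.+1 = i.*2 by lia_no_mem.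
  have Q1 : twin_gap S i.*2.-1 by rewrite /twin_gap i1S iE.
  have iq := max_q _ Q2.
  rewrite /f; case: ifPn => qiS; last by rewrite Q2 (negPf qiS); lia_no_mem.
  rewrite Q1; split=> /=; first by lia_no_mem.
  apply: contra (noP (q - i.*2) (leq_subr _ _)) => qi1S.
  by rewrite /twin_nongap qiS (_ : _.+1 = q - i.*2.-1) //; lia_no_mem.
have i0 : 0 < i by case: (i) iS => //; rewrite elements0.
have j0 : 0 < j by case: (j) jS => //; rewrite elements0.
by rewrite /f; case: ifP => _; case: ifP => _; lia_no_mem.
Qed.

(** Here 2t + 1 is the least odd element of S.  Adding it to the alternating
stretch between q and p shows that p + e - 1 is in S when e is even in the range
considered; if moreover e is in S, then p + e - 1 is a twin nongap.  It is not
of the form p + s with s in S, as e - 1 is odd and less than 2t + 1. *)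
Lemma even_nongaps_twin_nongaps (S : numSemigroup) q p t i0 :
    twin_nongap S p -> t.*2.+1 \in S ->
    (forall y, y < t.*2.+1 -> odd y -> y \notin S) ->
    (forall y, q < y <= p -> (y \in S) = (odd y == odd q)) ->
    odd p = odd q -> t.*2.+1 + p <= 2 * genus S -> t.*2.+1 <= q + 2 ->
    0 < i0 -> t.*2 + q + 4 <= p + i0.*2 ->
  census (fun x => x \in S) (2 * genus S - p)
    + census (fun i => (i0 <= i) && (i.*2 \in S)) t <= defect S.
Proof.
move=> Pp oS noO alt pq top oq i0_gt0 i0E; rewrite -census_twin_nongap.
rewrite (@census_split (twin_nongap S) (fun z => (p <= z) && (z - p \in S))).
apply: leq_add; first exact: twin_nongap_translate.
apply: (@census_inj _ _ _ _ (fun i => p + i.*2.-1)) => [i it /andP[i0i iS]|]; last first.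
  by move=> i j it jt /andP[i0i _] /andP[i0j _]; lia_no_mem.
have iE : i.*2.-1 = i.-1.*2.+1 by lia_no_mem.
have piS : p + i.*2.-1 \in S.
  have E : p + i.-1.*2 = t.*2 + (p + i.-1.*2 - t.*2) by lia_no_mem.
  rewrite iE addnS E -addSn elementsD // alt; last by lia_no_mem.
  by rewrite oddB ?oddD ?odd_double ?addbF ?pq //; lia_no_mem.
split; first by lia_no_mem.
rewrite addKn leq_addr /= (negPf (noO i.*2.-1 _ _)) ?andbT; first last.
- by rewrite iE /= odd_double.
- by lia_no_mem.
rewrite /twin_nongap piS (_ : _.+1 = p + i.*2); last by lia_no_mem.
by have [pS _] := andP Pp; rewrite elementsD.
Qed.

(** Let 2t + 1 be the least odd element of S, C the number of elements up to the
last twin gap q, and D the number of elements below 2g - p, where p is the first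
twin nongap.  As 2t + 1 + q + 2 > p, the number t exceeds (w - C) + (w - D) + 3.
There are h <= w - C even gaps below 2t.  If D <= C, this contradicts the fact
that gaps make up half of the even numbers up to the gap 2t, as then w - C <= w - D.
If D > C, then 2t + 1 <= 2g - p, so that at most w - D of the even numbers from
2 * i0 to 2t - 2 are in S and at most w - C are gaps, whereas there are t - i0 of
them, more than (w - C) + (w - D). *)
Lemma small_nongaps_even (S : numSemigroup) x :
  3 * defect S + 4 <= genus S -> x \in S -> x <= genus S -> ~~ odd x.
Proof.
set w := defect S => wg xS xg; apply/negP => ox.
have exo : exists y, (y \in S) && odd y by exists x; rewrite xS.
case: (ex_minnP exo) => o /andP[oS oo] min_o {exo}.
have [t ot] : exists t, o = t.*2.+1.
  by exists o./2; rewrite -[LHS]odd_double_half oo.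
have og : o <= genus S by apply: leq_trans xg; apply: min_o; rewrite xS.
move: min_o oS og; rewrite {o oo}ot => min_o oS og.
have noP y : y <= genus S -> ~~ twin_nongap S y.
  by move=> yg; apply/negP => /twin_nongap_bound; rewrite -/w; lia_no_mem.
have t2S : t.*2 \notin S.
  by apply: contra (noP t.*2 (ltnW og)); rewrite /twin_nongap oS => ->.
have noO y : y < t.*2.+1 -> odd y -> y \notin S.
  move=> yo oy; apply/negP => yS; have := min_o y.
  by rewrite yS oy => /(_ isT); rewrite leqNgt yo.
have t0 : 0 < t by case: (t) t2S => //; rewrite elements0.
have exq : exists y, twin_gap S y.
  exists t.-1.*2.+1; rewrite /twin_gap noO /= ?odd_double //; last by lia_no_mem.
  by rewrite (_ : _.+2 = t.*2) //; lia_no_mem.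
have [|q Qq max_q] := @ex_maxnP (twin_gap S) (3 * w) exq.
  by move=> y /twin_gap_bound; rewrite -/w; lia_no_mem.
have q_lt := twin_gap_bound _ _ Qq; rewrite -/w in q_lt.
have [qS q1S] := andP Qq.
have Qw : census (twin_gap S) q.+1 = w.
  rewrite /w /defect [RHS](@census_const _ q.+1) //.
    by rewrite ltnW // twin_gap_lt.
  by move=> y /andP[qy _]; apply/negP => /max_q; rewrite leqNgt qy.
have : 0 < w by rewrite -Qw; apply: census_gt0 Qq _.
rewrite /w -census_twin_nongap => /census_gt0_ex[p' p'g Pp'].
have exp : exists y, twin_nongap S y by exists p'.
case: (ex_minnP exp) => p Pp min_p {exp exq}.
have p_gt := twin_nongap_bound _ _ Pp; rewrite -/w in p_gt.
have p2g : p < 2 * genus S by apply: leq_ltn_trans p'g; apply: min_p.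
have qp : q < p by lia_no_mem.
have alt : forall y, q < y <= p -> (y \in S) = (odd y == odd q).
  apply: twin_free_alternate q1S _ => y /andP[qy yp]; apply/andP; split.
    by apply/negP => /max_q; rewrite leqNgt qy.
  by apply/negP => /min_p; rewrite leqNgt yp.
have pq : odd p = odd q.
  by have [pS _] := andP Pp; apply/eqP; rewrite -alt // qp leqnn.
have q2S : q + 2 \in S by rewrite alt ?oddD /= ?addbF ?eqxx //; lia_no_mem.
(* The stretch from q + 1 to p contains the least odd element at its start or
   not at all. *)
have oq : t.*2.+1 <= q + 2.
  case: (boolP (odd q)) => [q_odd|q_even].
    by apply: min_o; rewrite q2S oddD q_odd.
  rewrite leqNgt; apply/negP => qo; have := alt t.*2.+1.
  by rewrite oS /= odd_double (negPf q_even) => /(_ ltac:(lia_no_mem)).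
(* The sum of 2t + 1 and q + 2 has the wrong parity for the alternating stretch. *)
have oqp : p < t.*2.+1 + q + 2.
  rewrite ltnNge; apply/negP => oqp; have := alt (t.*2.+1 + (q + 2)).
  have -> : q < t.*2.+1 + (q + 2) <= p by lia_no_mem.
  by rewrite elementsD // !oddD /= odd_double; case: (odd q) => /(_ isT).
set C := census (fun x => x \in S) q.+1.
have CE : 2 * C + w = q + 2.
  have := balance S q.+1; rewrite q1S Qw -/C.
  rewrite (@census_const (twin_nongap S) 0 q.+1) // ?census0; first by lia_no_mem.
  by move=> y yq; apply: noP; lia_no_mem.
set D := census (fun x => x \in S) (2 * genus S - p).
have DE : 2 * genus S <= p + 2 * D + w.
  have := balance S (2 * genus S - p); rewrite -/D.
  have := leq_census (twin_gap S) _ _ (leq_subr p (2 * genus S)).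
  by rewrite -/(defect S) -/w; lia_no_mem.
pose h := census (fun i => i.*2 \notin S) t.
have Ch : C + h <= w.
  rewrite -Qw; apply: even_gaps_twin_gaps => // y yq; apply: noP; lia_no_mem.
have th : t < 2 * h.+1.
  have := @gap_census (fun i => i.*2 \in S) t; rewrite censusS t2S addn1; apply=> //.
  by move=> i j iS jS; rewrite doubleD elementsD.
have [DC|CD] := leqP D C; first by lia_no_mem.
have qp2 : q.+1 < 2 * genus S - p.
  rewrite ltnNge; apply/negP => /(leq_census (fun x => x \in S)).
  by rewrite -/C -/D leqNgt CD.
(* From 2 * i0 on, 2t + 1 added to the stretch reaches p + 2i - 1. *)
pose i0 := (t.*2.+1 + q + 3 - p)./2.
have i0E : i0.*2 = t.*2.+1 + q + 3 - p.
  rewrite -[RHS]odd_double_half oddB ?oddD ?pq /= ?odd_double; last by lia_no_mem.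
  by case: (odd q).
have De : D + census (fun i => (i0 <= i) && (i.*2 \in S)) t <= w.
  have top : t.*2.+1 + p <= 2 * genus S by lia_no_mem.
  by apply: even_nongaps_twin_nongaps Pp oS noO alt pq top oq _ _; lia_no_mem.
have : t - i0 <= h + census (fun i => (i0 <= i) && (i.*2 \in S)) t.
  have <- : census (leq i0) t = t - i0.
    by elim: (t) => // k IHk; rewrite censusS IHk; case: leqP; lia_no_mem.
  rewrite (@census_split (leq i0) (fun i => i.*2 \in S)) addnC leq_add2r.
  by apply: (@census_inj _ _ _ _ id) => // i it /andP[].
by lia_no_mem.
Qed.

(** * The semigroup of halves *)

(** The count [small_nongaps] includes 0, so this bounds r from below by half of
n = g - w, rounded down. *)
Lemma small_nongaps_defect (S : numSemigroup) :
  0 < genus S -> genus S + 1 <= 2 * small_nongaps S + defect S.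
Proof.
move=> g0; have := balance S (genus S).+1.
have := leq_census (twin_gap S) (genus S).+1 (2 * genus S).
by rewrite /small_nongaps -/(defect S); lia.
Qed.

Lemma small_nongapsE_half (S : numSemigroup) :
    (forall x, x \in S -> x <= genus S -> ~~ odd x) ->
  small_nongaps S = census (fun i => i.*2 \in S) (genus S)./2.+1.
Proof.
move=> evS; apply/eqP; rewrite eqn_leq; apply/andP; split.
  apply: (@census_inj _ _ _ _ half) => [x xg xS|x y xg yg xS yS E].
    by rewrite even_halfK ?evS //; split=> //; rewrite ltnS half_leq.
  by rewrite -(even_halfK (evS x xS xg)) E even_halfK ?evS.
apply: (@census_inj _ _ _ _ double) => [i ig iS|i j _ _ _ _ /double_inj //].
by split=> //; lia.
Qed.

(** Let c be the number of even gaps up to g.  In the semigroup S / 2, a gap up to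
g / 2 is less than 2c because gaps make up half of what precedes it.  This fills
the range from 2c to g / 2, which has more than c elements; S / 2 has a
nonzero element b <= c + 1, and adding b repeatedly fills everything beyond. *)
Lemma even_gaps_small (S : numSemigroup) :
    (forall x, x \in S -> x <= genus S -> ~~ odd x) ->
    genus S + 5 <= 3 * small_nongaps S ->
  forall i, 2 * ((genus S)./2.+1 - small_nongaps S) <= i -> i.*2 \in S.
Proof.
move=> evS; rewrite small_nongapsE_half //.
set h := (genus S)./2; have := censusC (fun i => i.*2 \in S) h.+1.
set r := census _ _; set c := census _ _ => rc big.
have -> : h.+1 - r = c by lia.
have hE : h.*2 <= genus S by rewrite /h; lia.
have cen_gap j M : j < M -> M <= h.+1 -> j.*2 \notin S -> j < 2 * c.
  move=> jM Mh jS.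
  have := @gap_census (fun i => i.*2 \in S) j.
  have := leq_census (fun i => i.*2 \notin S) _ _ (leq_trans jM Mh).
  move=> le_c H; suff : j < 2 * census (fun i => i.*2 \notin S) j.+1 by lia.
  by apply: H => // a b aS bS; rewrite doubleD elementsD.
have [b b0 [bc bS]] : exists2 b, 0 < b & b <= c.+1 /\ b.*2 \in S.
  have : 0 < census (fun i => i.+1.*2 \in S) c.+1.
    rewrite lt0n; apply/eqP => c0.
    have := censusC (fun i => i.+1.*2 \in S) c.+1; rewrite c0 add0n => c1.
    suff : census (fun i => i.+1.*2 \notin S) c.+1 <= c by rewrite c1 ltnn.
    apply: (@census_inj _ _ _ _ succn) => [i ic iS|i j _ _ _ _ []//].
    by split=> //; lia.
  by case/census_gt0_ex => b bc bS; exists b.+1.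
elim/ltn_ind => i IHi ci; apply: contraT => iS.
have hi : h < i.
  by rewrite ltnNge; apply/negP => ih; have := cen_gap i h.+1 ih (leqnn _) iS; lia.
suff : i.*2 \in S by rewrite (negPf iS).
have -> : i.*2 = b.*2 + (i - b).*2 by lia.
by rewrite elementsD //; apply: IHi; lia.
Qed.

(** An even gap is less than g, and the odd numbers up to g are gaps, so an even
gap is twinned with both neighbours; every twin gap involves an even one. *)
Lemma defect_even (S : numSemigroup) :
    (forall x, x \in S -> x <= genus S -> ~~ odd x) ->
    genus S + 5 <= 3 * small_nongaps S ->
  defect S = 2 * ((genus S)./2.+1 - small_nongaps S).
Proof.
move=> evS big; have evG := even_gaps_small _ evS big.
have srE := small_nongapsE_half _ evS.
set c := _ - _ in evG *.
have cE : census (fun i => i.*2 \notin S) (genus S)./2.+1 = c.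
  by have := censusC (fun i => i.*2 \in S) (genus S)./2.+1; rewrite -srE /c; lia.
have cg : 2 * c <= (genus S)./2.+1.
  by rewrite /c; lia.
have c4 : 4 * c <= genus S + 1 by rewrite /c; lia.
have oddG i : i.*2 \notin S -> i.*2.+1 \notin S /\ (0 < i -> i.*2.-1 \notin S).
  move=> iS; have ic : i < 2 * c by rewrite ltnNge; apply: contra iS => /evG.
  split=> [|i0]; apply/negP => H.
    by have := evS _ H; rewrite /= odd_double; lia.
  by have := evS _ H; rewrite (_ : i.*2.-1 = i.-1.*2.+1) /= ?odd_double; lia.
have big_cE N : 2 * c <= N -> census (fun i => i.*2 \notin S) N = c.
  move=> cN; rewrite -cE.
  have const M : 2 * c <= M -> census (fun i => i.*2 \notin S) M
      = census (fun i => i.*2 \notin S) (2 * c).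
    by move=> cM; apply: census_const => // x /andP[cx _]; rewrite negbK evG.
  by rewrite !const.
have QE K : census (twin_gap S) (2 * K) =
    census (fun i => i.*2 \notin S) K + (census (fun i => i.*2 \notin S) K.+1).
  elim: K => [|K IHK]; first by rewrite censusS elements0.
  rewrite mulnS !censusS IHK !censusS /twin_gap mul2n -doubleS.
  have oddK1 : K.+1.*2 \notin S -> K.*2.+1 \notin S by case/oddG=> _ /(_ isT).
  have oddK : K.*2 \notin S -> K.*2.+1 \notin S by case/oddG.
  case: (boolP (K.*2 \in S)) oddK => [_ _|_ /(_ isT) ->].
    by case: (boolP (K.+1.*2 \in S)) oddK1 => [|_ /(_ isT) ->]; rewrite ?andbF /=; lia.
  by case: (K.+1.*2 \in S) => /=; lia.
by rewrite /defect QE !big_cE; lia.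
Qed.

Theorem theorem17 (S : numSemigroup) (g n : nat) :
  genus S = g ->
  #|` gap_intervals S|%fset = n ->
  ((g%:R + 2) / 3 <= (n./2)%:R :> rat)%R ->
  odd g = odd n /\ ordinarization_number S = n./2.
Proof.
move=> <- <-; rewrite card_gap_intervals; set n' := census _ _.
rewrite ler_pdivrMr // -natrD -natrM ler_nat => le_gn.
have nw : n' + defect S = genus S.
  have := census_descent S (2 * genus S); rewrite census_twin_nongap -/n'.
  have := genus_census S _ (leqnn _).
  by have := censusC (fun x => x \in S) (2 * genus S); lia.
have wg : 3 * defect S + 4 <= genus S by lia.
have evS := small_nongaps_even S _ wg; have rw := small_nongaps_defect S ltac:(lia).
have := defect_even _ evS.
have := odd_double_half (genus S); have := odd_double_half n'.
rewrite ordinarization_numberE => nE gE /(_ ltac:(lia)) wE.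
have oddE : odd (genus S) = odd n'.
  by rewrite -nw wE oddD oddM addbF.
have := censusC (fun i => i.*2 \in S) (genus S)./2.+1.
rewrite -small_nongapsE_half // => sr.
by split=> //; rewrite oddE in gE; lia.
Qed.
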